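(* Let $n\geq k\geq l\geq 1$ be integers, and let $A_i=(0,2i-2)$, $B_i=(i-1,2i-2)$. Then $d_{k,l}(q)=\sum_{\Omega}\psi(\Omega)$, where the sum runs over all families $\Omega=(\omega_i)_{i\in[n]\setminus\{k\}}$ of pairwise disjoint lattice paths such that $\omega_i$ goes from $A_i$ to $B_i$ for $1\leq i<l$ and for $k<i\leq n$, and $\omega_i$ goes from $A_{i+1}$ to $B_i$ for $l\leq i<k$.
   Context: For $m\in\mathbb Z$, $r\in\mathbb N$: $(x;q)_r=(1-x)(1-xq)\cdots(1-xq^{r-1})$ and ${m\brack r}_q=\frac{(q^{m-r+1};q)_r}{(q;q)_r}$. Let $H_q$ be the lower unitriangular matrix with entries $(H_q)_{i,j}={-j\brack 2i-2j}_q\,q^{(i-j)(2i-1)}$ $(={2i-j-1\brack 2i-2j}_q)$ for $j\leq i$ and $0$ for $j>i$, and write $H_q^{-1}=((-1)^{i-j}d_{i,j}(q))_{i,j\geq 1}$. A lattice path from $(a,b)$ to $(c,d)$ is a sequence of integer points from $(a,b)$ to $(c,d)$ each step of which is $(1,0)$ or $(0,-1)$. For such a path $w$, $|\lambda_w|=\sum(x-a)$ over all steps $(0,-1)$ of $w$, $x$ being the abscissa of the step. Paths are disjoint if they share no point. For a family $\Omega=(\omega_i)$, $\psi(\Omega)=q^{\sum_i|\lambda_{\omega_i}|}$. *)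

(* Defs.v *)
From HB Require Import structures.
From mathcomp Require Import all_boot all_order all_algebra zify.
From mathcomp Require Import boolp classical_sets functions cardinality fsbigop.

Set Implicit Arguments.
Unset Strict Implicit.
Unset Printing Implicit Defensive.

Import Order.TTheory GRing.Theory Num.Theory.
Local Open Scope ring_scope.

Definition qpoch (F : fieldType) (q x : F) (r : nat) : F :=
  \prod_(0 <= t < r) (1 - x * q ^+ t).

(* The top argument is any integer, so [q ^ _] is the integer power. *)
Definition qbinom (F : fieldType) (q : F) (m : int) (r : nat) : F :=
  qpoch q (q ^ (m - r%:Z + 1)) r / qpoch q q r.

(* Infinite matrices with rows and columns indexed by the positive integers are
   functions [nat -> nat -> F]; values at index 0 are never used. *)
Definition Hq (F : fieldType) (q : F) (i j : nat) : F :=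
  if (j <= i)%N
  then qbinom q (- j%:Z) (2 * i - 2 * j) * q ^+ ((i - j) * (2 * i - 1))
  else 0.

Definition lower_triangular (F : fieldType) (A : nat -> nat -> F) : Prop :=
  forall i j, (1 <= i < j)%N -> A i j = 0.

(* The sum stops at [m = i], which covers the whole row of a lower triangular
   left factor. *)
Definition lmul (F : fieldType) (A B : nat -> nat -> F) (i j : nat) : F :=
  \sum_(1 <= m < i.+1) A i m * B m j.

Definition lower_inverse (F : fieldType) (A B : nat -> nat -> F) : Prop :=
  lower_triangular B /\
  forall i j, (1 <= i)%N -> (1 <= j)%N ->
    lmul A B i j = (i == j)%:R /\ lmul B A i j = (i == j)%:R.

Definition point : Type := (int * int)%type.

Definition down_step (P P' : point) : bool := P' == (P.1, P.2 - 1).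

Definition lattice_step (P P' : point) : bool :=
  (P' == (P.1 + 1, P.2)) || down_step P P'.

Definition lattice_path (P Q : point) (w : seq point) : bool :=
  if w is p :: w' then
    [&& p == P, path lattice_step p w' & last p w' == Q]
  else false.

(* [zip w (behead w)] lists the steps of [w] as pairs of consecutive points. *)
Definition path_area (w : seq point) : int :=
  \sum_(s <- zip w (behead w) | down_step s.1 s.2)
    (s.1.1 - (head (0, 0) w).1).

Definition ptA (i : nat) : point := (0, 2 * i%:Z - 2).
Definition ptB (i : nat) : point := (i%:Z - 1, 2 * i%:Z - 2).

(* The index set {1, ..., n} minus {k}. *)
Definition pidx (n k : nat) : Type :=
  {i : 'I_n.+1 | (1 <= i)%N && (i != k :> nat)}.

Definition pidx_nat (n k : nat) (i : pidx n k) : nat := val (val i).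
Coercion pidx_nat : pidx >-> nat.

Definition path_family (n k : nat) : Type := {ffun pidx n k -> seq point}.

Definition path_start (k l i : nat) : point :=
  if (l <= i < k)%N then ptA i.+1 else ptA i.

Definition disjoint_families (n k l : nat) : set (path_family n k) :=
  [set Omega : path_family n k |
    (forall i : pidx n k,
       lattice_path (path_start k l i) (ptB i) (Omega i)) /\
    (forall i j : pidx n k, i != j -> ~~ has (mem (Omega i)) (Omega j))]%classic.
Arguments disjoint_families : clear implicits.

Definition psi (F : fieldType) (q : F) (n k : nat) (Omega : path_family n k) :
    F :=
  q ^ (\sum_i path_area (Omega i)).

Section Wellposedness.
Variable F : fieldType.
Implicit Types A B C : nat -> nat -> F.

Definition lower_unitriangular A : Prop :=
  lower_triangular A /\ forall i, (1 <= i)%N -> A i i = 1.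

Lemma Hq_lower_unitriangular (q : F) : lower_unitriangular (Hq q).
Proof.
split=> [i j /andP[_ ij]|i _]; rewrite /Hq; first by rewrite leqNgt ij.
by rewrite leqnn !subnn mul0n expr0 mulr1 /qbinom /qpoch !big_geq // divr1.
Qed.

Let rows A := fix rows (n : nat) : nat -> nat -> F :=
  if n is p.+1 then fun i j =>
    if i == p.+1 then (i == j)%:R - \sum_(1 <= m < p.+1) A p.+1 m * rows p m j
    else rows p i j
  else fun _ _ => 0.

Let rowsE A n i j : (i <= n)%N -> rows A n i j = rows A i i j.
Proof.
elim: n => [|n IHn]; first by rewrite leqn0 => /eqP->.
rewrite leq_eqVlt ltnS => /predU1P[->//|lein] /=.
by rewrite ltn_eqF ?ltnS // IHn.
Qed.

Let rinv A i j := rows A i i j.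

Let rinvE A i j : (1 <= i)%N ->
  rinv A i j = (i == j)%:R - \sum_(1 <= m < i) A i m * rinv A m j.
Proof.
case: i => // i _; rewrite /rinv /= eqxx; congr (_ - _).
by apply: eq_big_nat => m /andP[_ lemi]; rewrite rowsE.
Qed.

Let rinv_unitri A : lower_unitriangular (rinv A).
Proof.
have rtri : lower_triangular (rinv A).
  move=> i j; elim/ltn_ind: i => i IHi /andP[i1 ij].
  rewrite rinvE // ltn_eqF // big_nat_cond big1 ?subr0 // => m.
  by rewrite andbT => /andP[m1 mi]; rewrite IHi ?mulr0 // m1 (ltn_trans mi).
split=> // i i1; rewrite rinvE // eqxx big_nat_cond big1 ?subr0 // => m.
by rewrite andbT => mi; rewrite rtri ?mulr0.
Qed.

Let rinvP A i j : lower_unitriangular A -> (1 <= i)%N ->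
  lmul A (rinv A) i j = (i == j)%:R.
Proof.
move=> [_ A1] i1; rewrite /lmul big_nat_recr //= A1 // mul1r (rinvE _ _ i1).
by rewrite addrCA addrN addr0.
Qed.

Let lmulA A B C i j : lower_triangular B ->
  lmul (lmul A B) C i j = lmul A (lmul B C) i j.
Proof.
move=> Btri; rewrite /lmul.
under eq_bigr do rewrite mulr_suml.
rewrite exchange_big_nat /=; apply: eq_big_nat => p /andP[p1 pi].
rewrite mulr_sumr (big_cat_nat _ (n := p.+1)) //= [X in _ + X]big_nat_cond.
rewrite [X in _ + X]big1 ?addr0 => [|m]; last first.
  by rewrite andbT => /andP[pm _]; rewrite Btri ?p1 // mulr0 mul0r.
by apply: eq_bigr => m _; rewrite mulrA.
Qed.

Lemma lower_inverse_exists A :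
  lower_unitriangular A -> exists B, lower_inverse A B.
Proof.
move=> Atri; pose B := rinv A; pose C := rinv B.
have Btri : lower_unitriangular B := rinv_unitri A.
have AC i j : (1 <= i)%N -> (1 <= j)%N -> A i j = C i j.
  move=> i1 j1; transitivity (lmul A (lmul B C) i j).
    rewrite {1}/lmul (eq_big_nat _ _ (F2 := fun m => A i m * (m == j)%:R)).
      have [ji|ij] := leqP j i.
        rewrite (bigD1_seq j) ?iota_uniq ?mem_index_iota ?j1 //= eqxx mulr1.
        by rewrite big1 ?addr0 // => m /negPf->; rewrite mulr0.
      rewrite big_nat_cond big1 ?(proj1 Atri) ?i1 // => m.
      rewrite andbT => /andP[_ mi].
      by rewrite ltn_eqF ?mulr0 // (leq_ltn_trans _ ij).
    by move=> m /andP[m1 _]; rewrite rinvP.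
  rewrite -lmulA; last exact: (proj1 Btri).
  rewrite {1}/lmul.
  rewrite (bigD1_seq i) ?iota_uniq ?mem_index_iota ?i1 //= ?ltnSn //.
  rewrite rinvP // eqxx mul1r big1 ?addr0 // => m mi.
  by rewrite rinvP // eq_sym (negPf mi) mul0r.
exists B; split=> [|i j i1 j1]; first exact: proj1 Btri.
split; first exact: rinvP.
rewrite -(rinvP j Btri i1); apply: eq_big_nat => m /andP[m1 _].
by rewrite AC.
Qed.

End Wellposedness.

Definition word_step (p : point) (b : bool) : point :=
  if b then (p.1 + 1, p.2) else (p.1, p.2 - 1).

Lemma lattice_path_word (P Q : point) (w : seq point) : lattice_path P Q w ->
  exists2 s : seq bool, w = P :: scanl word_step P s
    & (size s)%:Z = (Q.1 - P.1) + (P.2 - Q.2).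
Proof.
case: w => // p w /and3P[/eqP-> pw /eqP <-] {p Q}.
elim: w P pw => [|p w IHw] P /=.
  by exists [::] => //=; rewrite !subrr.
case/andP=> Pp /IHw[s {1}-> sz].
have [b pE] : exists b, p = word_step P b.
  by case/orP: Pp => /eqP->; [exists true | exists false].
exists (b :: s); first by rewrite /= -pE.
by move: sz; rewrite pE /= -add1n PoszD => ->; case: b {pE} => /=; lia.
Qed.

(* Hence the [\sum_(Omega \in disjoint_families n k l) _] is a genuine
   finite sum and not the default value of [\sum_(_ \in _) _]. *)
Lemma disjoint_families_finite (n k l : nat) :
  finite_set (disjoint_families n k l).
Proof.
pose f (s : {ffun pidx n k -> {bseq n.+3 of bool}}) : path_family n k :=
  [ffun i : pidx n k => path_start k l i ::
     scanl word_step (path_start k l i) (s i)].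
apply: (@sub_finite_set _ _ (f @` setT)%classic); last first.
  exact/finite_image/finite_finset.
move=> Omega [wP _].
have wB (i : pidx n k) : exists s : {bseq n.+3 of bool},
    Omega i = path_start k l i :: scanl word_step (path_start k l i) s.
  have [s -> sz] := lattice_path_word (wP i).
  have ss : (size s <= n.+3)%N.
    have := ltn_ord (val i); move: sz; rewrite -/(pidx_nat i) /path_start.
    by case: ifP => _ /=; rewrite /pidx_nat /=; lia.
  by exists (Bseq ss).
have [g gP] := choice wB; exists (finfun g) => //.
by apply/ffunP => i; rewrite !ffunE gP.
Qed.

(* Main.v *)
Require Import Defs.
From mathcomp Require Import all_boot all_order all_algebra zify ring.
From mathcomp Require Import boolp classical_sets functions cardinality fsbigop.

(* A path omega_i with k < i or i < l is forced to be horizontal and meets no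
   other path.  For l <= i < k, the path omega_i makes its two down steps at
   abscissas a_i <= b_i < i, contributes q^(a_i + b_i), and omega_i and
   omega_(i+1) are disjoint iff a_i < b_(i+1).  Inclusion-exclusion on the
   violations of these inequalities, starting from i = l, produces blocks
   b_l >= a_l >= b_(l+1) >= ... >= a_(m-1), which are the partitions counted by
   the q-binomial (H_q)_(m,l).  The resulting alternating recursion on l is the
   one which characterizes the rows of H_q^-1. *)

Set Implicit Arguments.
Unset Strict Implicit.
Unset Printing Implicit Defensive.

Import Order.TTheory GRing.Theory Num.Theory.
Local Open Scope ring_scope.

(** * Generating functions of partitions and of chains, and the inverse of [Hq] *)

Section Algebra.
Variables (F : fieldType) (q : F).
Hypothesis q_neq0 : q != 0.
Hypothesis (q_nonroot : forall r : nat, (0 < r)%N -> q ^+ r != 1).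

(* Generating function of the partitions with [r] parts, all at most [c]. *)
Fixpoint part_gf (r c : nat) : F :=
  if r is r'.+1 then \sum_(0 <= b < c.+1) q ^+ b * part_gf r' b else 1.

Lemma part_gfSS r c :
  part_gf r.+1 c.+1 = part_gf r.+1 c + q ^+ c.+1 * part_gf r c.+1.
Proof. by rewrite /= big_nat_recr. Qed.

(** This makes [part_gf r c] the Gaussian binomial of [r + c] over [r]. With the denominator
    cleared, the q-Pascal rule [part_gfSS] drives a double induction on [r] and [c]. *)
Lemma part_gf_qpoch r c : part_gf r c * qpoch q q r = qpoch q (q ^+ c.+1) r.
Proof.
elim: r c => [|r IHr] c; first by rewrite /qpoch !big_geq // mulr1.
elim: c => [|c IHc].
  rewrite expr1 /= big_nat1 expr0 mul1r -[RHS]mul1r; congr (_ * _).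
  by elim: r {IHr} => //= r IHr; rewrite big_nat1 expr0 mul1r.
rewrite part_gfSS mulrDl IHc.
have qpochSr x : qpoch q x r.+1 = qpoch q x r * (1 - x * q ^+ r).
  by rewrite /qpoch big_nat_recr.
have qpochSl x : qpoch q x r.+1 = (1 - x) * qpoch q (x * q) r.
  rewrite /qpoch big_nat_recl // expr0 mulr1; congr (_ * _).
  by apply: eq_bigr => t _; rewrite exprS mulrA.
(* Peeling the first factor here and the last ones elsewhere gives all terms the common factor
   [qpoch q (q ^+ c.+2) r]. *)
rewrite [X in X + _]qpochSl -exprSr [X in _ * _ * X]qpochSr.
have -> : q ^+ c.+1 * part_gf r c.+1 * (qpoch q q r * (1 - q * q ^+ r)) =
   q ^+ c.+1 * (1 - q * q ^+ r) * (part_gf r c.+1 * qpoch q q r) by ring.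
by rewrite IHr qpochSr (exprSr q c.+1); ring.
Qed.

Lemma qpoch_neq0 r : qpoch q q r != 0.
Proof.
rewrite /qpoch prodf_seq_neq0; apply/allP => t _ /=.
by rewrite -exprS subr_eq0 eq_sym q_nonroot.
Qed.

(** Reversing the product turns its factors into [1 - q^-(j+u)], and multiplying such a factor by
    [q^(j+u)] gives [-(1 - q^(j+u))]. *)
Lemma qpoch_neg (j r : nat) :
  qpoch q (q ^ (- j%:Z - r%:Z + 1)) r * q ^+ (\sum_(0 <= u < r) (j + u)) =
  (-1) ^+ r * qpoch q (q ^+ j) r.
Proof.
rewrite /qpoch big_nat_rev /= add0n.
rewrite (eq_big_nat _ _ (F2 := fun u => 1 - q ^ (- (j + u)%N%:Z))); last first.
  move=> u ur; rewrite exprnP -expfzDr //; congr (1 - q ^ _); lia.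
elim: r => [|r IHr]; first by rewrite !big_geq // !mulr1.
rewrite !big_nat_recr //= exprD mulrACA IHr exprS mulN1r.
rewrite mulrBl mul1r [in q ^ _ * _]exprnP -expfzDr // addNr expr0z -exprD; ring.
Qed.

(** The power of [q] in [Hq] is exactly the one that [qpoch_neg] absorbs, and no sign remains
    because the number [2(i-j)] of factors is even. *)
Lemma Hq_part_gf i j : (1 <= j <= i)%N -> Hq q i j = part_gf (2 * (i - j)) j.-1.
Proof.
case/andP=> j1 ji; rewrite /Hq ji /qbinom -mulnBr.
apply: (mulIf (qpoch_neq0 (2 * (i - j)))); rewrite part_gf_qpoch prednK //.
rewrite mulrAC divfK ?qpoch_neq0 //.
have -> : ((i - j) * (2 * i - 1) = \sum_(0 <= u < 2 * (i - j)) (j + u))%N.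
  have -> : (i = i - j + j)%N by lia.
  rewrite addnK; elim: (i - j)%N => [|s IHs]; first by rewrite big_geq.
  by rewrite mulnS !big_nat_recr //= -IHs; nia.
by rewrite qpoch_neg mulnC exprM sqrr_sign mul1r.
Qed.

(* Generating function of the sequences of [r] pairs [(a_i, b_i)],
   [m <= i < m + r], with [a_i <= b_i < i], [a_i < b_(i+1)] and [c <= b_m]. *)
Fixpoint chain_gf (r m c : nat) : F :=
  if r is r'.+1 then
    \sum_(c <= b < m)
      q ^+ b * \sum_(0 <= a < b.+1) q ^+ a * chain_gf r' m.+1 a.+1
  else 1.

(** The left side counts the sequences with [b_m <= c]. Their condition [a_m < b_(m+1)] is dropped
    and its violations are subtracted; these are given by induction with [a_m] in place of [c]. Term
    [t] thus has a decreasing block of [t+1] pairs, that is [2(t+1)] parts at most [c], followed by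
    a sequence free of any condition linking it to the block. *)
Lemma chain_gf_compl r m c : (c < m)%N ->
  chain_gf r m 0 - chain_gf r m c.+1 =
  \sum_(0 <= t < r) (-1) ^+ t * part_gf (2 * t.+1) c
    * chain_gf (r - t.+1) (m + t.+1) 0.
Proof.
elim: r m c => [|r IHr] m c cm; first by rewrite big_geq // subrr.
rewrite {1 2}/chain_gf -/chain_gf (big_cat_nat (n := c.+1)) //= addrK.
transitivity (\sum_(0 <= b < c.+1) q ^+ b * \sum_(0 <= a < b.+1) q ^+ a *
   (chain_gf r m.+1 0 - \sum_(0 <= t < r) (-1) ^+ t * part_gf (2 * t.+1) a
      * chain_gf (r - t.+1) (m.+1 + t.+1) 0)).
  apply: eq_big_nat => b bc; congr (_ * _); apply: eq_big_nat => a ab.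
  by rewrite -IHr ?subKr //; lia.
rewrite [RHS]big_nat_recl // expr0 mul1r subSS subn0 addn1.
have sumsB (f g : nat -> F) :
    \sum_(0 <= b < c.+1) q ^+ b * \sum_(0 <= a < b.+1) q ^+ a * (f a - g a) =
    \sum_(0 <= b < c.+1) q ^+ b * \sum_(0 <= a < b.+1) q ^+ a * f a -
    \sum_(0 <= b < c.+1) q ^+ b * \sum_(0 <= a < b.+1) q ^+ a * g a.
  rewrite -sumrB; apply: eq_bigr => b _; rewrite -mulrBr -sumrB.
  by congr (_ * _); apply: eq_bigr => a _; rewrite mulrBr.
(* The part without violation is the term [t = 0], whose block is the single pair [(a_m, b_m)]; the
   other part puts this pair in front of each shorter block. *)
rewrite sumsB; congr (_ + _).
  rewrite mulr_suml; apply: eq_bigr => b _; rewrite -mulrA mulr_suml.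
  by congr (_ * _); apply: eq_bigr => a _; rewrite mulr1.
transitivity (- \sum_(0 <= b < c.+1) \sum_(0 <= t < r)
    q ^+ b * \sum_(0 <= a < b.+1) q ^+ a *
      ((-1) ^+ t * part_gf (2 * t.+1) a * chain_gf (r - t.+1) (m.+1 + t.+1) 0)).
  congr (- _); apply: eq_bigr => b _; rewrite -mulr_sumr exchange_big /=.
  by congr (_ * _); apply: eq_bigr => a _; rewrite mulr_sumr.
rewrite exchange_big -sumrN; apply: eq_bigr => t _.
rewrite subSS addSnnS exprS mulN1r !mulNr mulr_sumr mulr_suml.
congr (- _); apply: eq_bigr => b _.
(* This is what unfolding [part_gf (2 * t.+2)] leaves as the number of parts once [b] is removed;
   the next unfolding removes [a]. *)
have -> : (t.+1 + 1 * t.+2)%coq_nat = (2 * t.+1).+1 by lia.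
rewrite mulrCA -!mulrA; congr (_ * _).
rewrite /= mulr_suml mulr_sumr; apply: eq_bigr => a _; ring.
Qed.

(** Case [c = m - 1] of [chain_gf_compl]: since [b_m < m], the subtracted sum is empty. *)
Lemma chain_gfS r m : (0 < m)%N -> chain_gf r.+1 m 0 =
  \sum_(0 <= t < r.+1) (-1) ^+ t * part_gf (2 * t.+1) m.-1
    * chain_gf (r - t) (m + t.+1) 0.
Proof.
move=> m0; rewrite -[LHS]subr0 -(chain_gf_compl r.+1) ?prednK //.
by congr (_ - _); rewrite /= big_geq.
Qed.

(** Entry [(k, l)] of the product of the inverse by [Hq], solved for the term containing [d k l], is
    the recursion [chain_gfS]; the induction is on [k - l], with [k] fixed. *)
Lemma inverse_chain_gf (d : nat -> nat -> F) k l :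
  lower_inverse (Hq q) (fun i j => (-1) ^+ (i - j) * d i j) ->
  (1 <= l <= k)%N -> d k l = chain_gf (k - l) l 0.
Proof.
move=> [_ dE] /andP[l1 lk].
have [r rE] : {r | r = k - l}%N by exists (k - l)%N.
rewrite -rE; elim/ltn_ind: r l l1 lk rE => r IHr l l1 lk rE.
have k1 := leq_trans l1 lk.
have [_] := dE k l k1 l1; rewrite /lmul (big_cat_nat (n := l)) //=; last lia.
rewrite big_nat_cond big1 ?add0r; last first.
  by move=> i; rewrite andbT /Hq => /andP[_ il]; rewrite leqNgt il mulr0.
have Hll : Hq q l l = 1 by have [_ ->] := Hq_lower_unitriangular q.
rewrite big_ltn ?ltnS // Hll mulr1 -rE.
case: r IHr rE => [_ rE|r IHr rE].
  have -> : k = l by lia.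
  by rewrite big_geq // addr0 expr0 mul1r eqxx.
rewrite gtn_eqF; last by lia.
move/eqP; rewrite addr_eq0 => /eqP/(congr1 ( *%R ((-1) ^+ r.+1))).
rewrite mulrA -expr2 sqrr_sign mul1r => ->.
have -> : k.+1 = (r.+1 + l.+1)%N by lia.
rewrite -{1}[l.+1]add0n big_addn addnK chain_gfS // mulrN mulr_sumr -sumrN.
apply: eq_big_nat => t /andP[_ tr].
rewrite (IHr (r - t)%N) ?Hq_part_gf; try lia.
have -> : (k - (t + l.+1) = r - t)%N by lia.
have -> : (t + l.+1 - l = t.+1)%N by lia.
have -> : (t + l.+1 = l + t.+1)%N by lia.
have -> : (-1) ^+ t = - ((-1) ^+ r.+1 * (-1) ^+ (r - t)) :> F.
  have {1}-> : (r.+1 = t + (r - t) + 1)%N by lia.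
  by rewrite !exprD expr1 mulrN1 mulNr opprK -mulrA -expr2 sqrr_sign mulr1.
ring.
Qed.

End Algebra.

(** * Shape and area of the lattice paths *)

Fixpoint hseg (x y : int) (m : nat) : seq Defs.point :=
  (x, y) :: if m is m'.+1 then hseg (x + 1) y m' else [::].

Lemma mem_hseg x y m (P : Defs.point) :
  (P \in hseg x y m) = (P.2 == y) && (x <= P.1 <= x + m%:Z).
Proof.
case: P => u v; elim: m x => [|m IHm] x; rewrite inE ?IHm xpair_eqE /=; lia.
Qed.

Lemma lattice_path_hseg x y m :
  lattice_path (x, y) (x + m%:Z, y) (hseg x y m).
Proof.
rewrite /lattice_path; elim: m x => [|m IHm] x; first by rewrite /= addr0 !eqxx.
have := IHm (x + 1); rewrite -addrA -intS.
by case: m {IHm} => [|m] /=; rewrite /lattice_step /= !eqxx.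
Qed.

Lemma lattice_path_cat x y x' y' Q w w' :
  lattice_path (x, y) (x', y') w -> lattice_path (x', y' - 1) Q w' ->
  lattice_path (x, y) Q (w ++ w').
Proof.
case: w => // p w /and3P[/eqP-> pw lw].
case: w' => // p' w' /and3P[/eqP-> pw' lw'].
apply/and3P; split; rewrite ?eqxx // ?last_cat //.
by rewrite cat_path pw /= (eqP lw) pw' /lattice_step /down_step /= eqxx orbT.
Qed.

Lemma lattice_path_cons P Q p p' w : lattice_path P Q [:: p, p' & w] =
  [&& p == P, lattice_step P p' & lattice_path p' Q (p' :: w)].
Proof.
by rewrite /lattice_path eqxx; have [->|] := eqVneq p P; rewrite //= andbA.
Qed.

Lemma lattice_path_down P Q w : lattice_path P Q w -> Q.2 <= P.2.
Proof.
case: w => // p w; elim: w P p => [|p' w IHw] P p.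
  by case/and3P=> /eqP-> _ /eqP<-.
rewrite lattice_path_cons => /and3P[_ Pp' /IHw]; move: Pp'.
by rewrite /lattice_step /down_step => /orP[] /eqP-> /=; lia.
Qed.

(** A down step would bring the path below its endpoint, which [lattice_path_down] excludes. *)
Lemma lattice_path_flat (x y x' : int) w : lattice_path (x, y) (x', y) w ->
  exists2 m : nat, x' = x + m%:Z & w = hseg x y m.
Proof.
case: w => // p w; elim: w x p => [|p' w IHw] x p.
  by case/and3P=> /eqP-> _ /eqP[<-]; exists 0; rewrite ?addr0.
rewrite lattice_path_cons => /and3P[/eqP-> /orP[] /eqP->].
  by case/IHw=> m -> ->; exists m.+1 => //; rewrite -addrA intS.
by move=> /lattice_path_down /=; lia.
Qed.

Lemma lattice_path_fall (x y x' y' : int) w : y' < y ->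
    lattice_path (x, y) (x', y') w ->
  exists (m : nat) (w' : seq Defs.point), w = hseg x y m ++ w' /\
    lattice_path (x + m%:Z, y - 1) (x', y') w'.
Proof.
move=> y'y; case: w => // p w; elim: w x p => [|p' w IHw] x p.
  by case/and3P=> /eqP-> _ /eqP[_ y'E]; rewrite y'E ltxx in y'y.
rewrite lattice_path_cons => /and3P[/eqP-> /orP[] /eqP->].
  case/IHw=> m [w' [-> ww']]; exists m.+1, w'; split=> //.
  by rewrite intS addrA.
by move=> ww'; exists 0, ((x, y - 1) :: w); rewrite addr0.
Qed.

(* The lattice path from [ptA i.+1] to [ptB i] whose down steps are at abscissas
   [a] and [b]. *)
Definition vpath (i a b : nat) : seq Defs.point :=
  hseg 0 (2 * i%:Z) a ++ hseg a%:Z (2 * i%:Z - 1) (b - a) ++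
  hseg b%:Z (2 * i%:Z - 2) (i.-1 - b).

Lemma mem_vpath i a b (P : Defs.point) : (a <= b < i)%N ->
  (P \in vpath i a b) =
  [|| (P.2 == 2 * i%:Z) && (0 <= P.1 <= a%:Z),
      (P.2 == 2 * i%:Z - 1) && (a%:Z <= P.1 <= b%:Z) |
      (P.2 == 2 * i%:Z - 2) && (b%:Z <= P.1 <= i%:Z - 1)].
Proof. by move=> abi; rewrite !mem_cat !mem_hseg; lia. Qed.

Lemma vpath_inj i a b a' b' : (a <= b < i)%N -> (a' <= b' < i)%N ->
  vpath i a b = vpath i a' b' -> (a, b) = (a', b').
Proof.
move=> abi abi' /(congr1 mem) E.
have {}E P : (P \in vpath i a b) = (P \in vpath i a' b') by rewrite E.
(* The rightmost points of the top and middle rows determine the two abscissas. *)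
have := E (a%:Z, 2 * i%:Z); have := E (a'%:Z, 2 * i%:Z).
have := E (b%:Z, 2 * i%:Z - 1); have := E (b'%:Z, 2 * i%:Z - 1).
by rewrite !mem_vpath //= => *; congr (_, _); lia.
Qed.

Lemma lattice_path_vpath i w : (0 < i)%N ->
  lattice_path (ptA i.+1) (ptB i) w <->
  exists a b, (a <= b < i)%N /\ w = vpath i a b.
Proof.
move=> i0; have AE : ptA i.+1 = (0, 2 * i%:Z).
  by rewrite /ptA; congr (_, _); lia.
rewrite AE; split=> [|[a [b [abi ->]]]].
  case/lattice_path_fall=> [|a [w1 [->]]]; first by lia.
  case/lattice_path_fall=> [|b [w2 [->]]]; first by lia.
  have -> : 2 * i%:Z - 1 - 1 = 2 * i%:Z - 2 by lia.
  case/lattice_path_flat=> c bc ->.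
  (* Here [b] is the length of the middle segment, which starts at abscissa [a]. *)
  exists a, (a + b)%N; split; first by lia.
  rewrite /vpath; congr (hseg _ _ _ ++ (hseg _ _ _ ++ hseg _ _ _))%SEQ; lia.
have := lattice_path_hseg 0 (2 * i%:Z) a; rewrite add0r.
move/lattice_path_cat; apply.
have := lattice_path_hseg a%:Z (2 * i%:Z - 1) (b - a).
rewrite -PoszD subnKC; last by lia.
move/lattice_path_cat; apply.
have := lattice_path_hseg b%:Z (2 * i%:Z - 2) (i.-1 - b).
have -> : 2 * i%:Z - 1 - 1 = 2 * i%:Z - 2 by lia.
have -> // : b%:Z + (i.-1 - b)%N%:Z = i%:Z - 1 by lia.
Qed.

Lemma lattice_path_ptAB i w : (0 < i)%N ->
  lattice_path (ptA i) (ptB i) w <-> w = hseg 0 (2 * i%:Z - 2) i.-1.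
Proof.
move=> i0; split=> [/lattice_path_flat[m mi ->]|->].
  by congr hseg; lia.
have := lattice_path_hseg 0 (2 * i%:Z - 2) i.-1.
by have -> : 0 + i.-1%:Z = i%:Z - 1 by lia.
Qed.

(* [path_area w] only sees its base abscissa through [x0], which is what makes
   it additive over concatenation. *)
Definition area_from (x0 : int) (w : seq Defs.point) : int :=
  \sum_(s <- zip w (behead w) | down_step s.1 s.2) (s.1.1 - x0).

Lemma area_from_cons x0 p p' w : area_from x0 [:: p, p' & w] =
  (if down_step p p' then p.1 - x0 else 0) + area_from x0 (p' :: w).
Proof. by rewrite /area_from /= big_cons; case: ifP; rewrite ?add0r. Qed.

Lemma down_step_right x y : down_step (x, y) (x + 1, y) = false.
Proof. by rewrite /down_step xpair_eqE /=; lia. Qed.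

Lemma area_from_hseg x0 x y m : area_from x0 (hseg x y m) = 0.
Proof.
elim: m x => [|m IHm] x; first by rewrite /area_from big_nil.
have := IHm (x + 1); rewrite [hseg x y m.+1]/=.
by case: m {IHm} => [|m] /= E; rewrite area_from_cons down_step_right E.
Qed.

(** The second segment is explicit so that the step joining the pieces is visibly a down step. *)
Lemma area_from_hseg_cat x0 x y m m' w :
  area_from x0 (hseg x y m ++ hseg (x + m%:Z) (y - 1) m' ++ w) =
  (x + m%:Z - x0) + area_from x0 (hseg (x + m%:Z) (y - 1) m' ++ w).
Proof.
elim: m x => [|m IHm] x.
  rewrite addr0 /= {1}/hseg -/hseg.
  by case: m' => [|m'] /=; rewrite area_from_cons /down_step eqxx.
have := IHm (x + 1); rewrite -addrA -intS [hseg x y m.+1]/= => <-.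
by case: m {IHm} => [|m] /=; rewrite area_from_cons down_step_right add0r.
Qed.

Lemma path_area_hseg x y m : path_area (hseg x y m) = 0.
Proof. by rewrite -(area_from_hseg x x y m); case: m. Qed.

Lemma path_area_vpath i a b : (a <= b)%N ->
  path_area (vpath i a b) = (a + b)%N%:Z.
Proof.
move=> ab; transitivity (area_from 0 (vpath i a b)); first by case: a ab.
have := area_from_hseg_cat 0 0 (2 * i%:Z) a (b - a)
  (hseg b%:Z (2 * i%:Z - 2) (i.-1 - b)).
rewrite !add0r subr0 /vpath => ->.
have := area_from_hseg_cat 0 a%:Z (2 * i%:Z - 1) (b - a) (i.-1 - b) [::].
rewrite -PoszD subnKC // subr0 cats0 -addrA => ->.
by rewrite area_from_hseg addr0 PoszD.
Qed.

(** * Enumeration of the sequences counted by [chain_gf] *)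

Fixpoint chains (r m c : nat) : seq (seq (nat * nat)) :=
  if r is r'.+1 then
    [seq ab :: s | ab <- [seq (a, b) | b <- index_iota c m,
                                       a <- index_iota 0 b.+1],
                   s <- chains r' m.+1 ab.1.+1]
  else [:: [::]].

Lemma chain_gf_chains (F : fieldType) (q : F) r m c :
  chain_gf q r m c =
  \sum_(s <- chains r m c) q ^+ (\sum_(ab <- s) (ab.1 + ab.2)).
Proof.
elim: r m c => [|r IHr] m c; first by rewrite /= big_seq1 big_nil.
rewrite [LHS]/= /chains -/chains big_allpairs_dep big_allpairs_dep.
apply: eq_bigr => b _.
rewrite mulr_sumr; apply: eq_bigr => a _.
rewrite IHr !mulr_sumr; apply: eq_bigr => s _.
by rewrite big_cons !exprD mulrA (mulrC (q ^+ a)).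
Qed.

Lemma chains_uniq r m c : uniq (chains r m c).
Proof.
elim: r m c => [//|r IHr] m c; apply: allpairs_uniq_dep => //.
- apply: allpairs_uniq_dep => [|b _|]; rewrite ?iota_uniq //.
  by move=> [b a] [b' a'] _ _ /= [-> ->].
- by move=> [ab s] [ab' s'] _ _ /= [-> ->].
Qed.

Lemma mem_chainsS r m c (ab : nat * nat) (s : seq (nat * nat)) :
  ab :: s \in chains r.+1 m c =
  [&& (c <= ab.2 < m)%N, (ab.1 <= ab.2)%N & s \in chains r m.+1 ab.1.+1].
Proof.
apply/allpairsPdep/and3P => [[ab' [s' [ab'P s'P [-> ->]]]]|[cb ab_le sP]].
  case/allpairsPdep: ab'P s'P => b [a [+ + ->]] /=.
  by rewrite !mem_index_iota => -> /= ab_le ->.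
exists ab, s; split=> //; apply/allpairsPdep; exists ab.2, ab.1.
by rewrite !mem_index_iota -surjective_pairing.
Qed.

(** The index-wise form of the recursive conditions is the one comparable with a family of paths:
    for [m = l], entry [t] describes the path of index [l + t]. *)
Lemma chainsP r m c s : reflect
  [/\ size s = r, (0 < r)%N -> (c <= (nth (0, 0)%N s 0).2)%N,
      forall t, (t < r)%N ->
        ((nth (0, 0)%N s t).1 <= (nth (0, 0)%N s t).2 < m + t)%N &
      forall t, (t.+1 < r)%N ->
        ((nth (0, 0)%N s t).1 < (nth (0, 0)%N s t.+1).2)%N]
  (s \in chains r m c).
Proof.
apply: (iffP idP); elim: r m c s => [|r IHr] m c [|ab s] //.
- by case/allpairsPdep=> ? [? []].
- rewrite mem_chainsS => /and3P[cb abP /IHr[sz s0 s1 s2]].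
  split=> [|_|[|t] tr|[|t] tr] /=; first by rewrite sz.
  + by lia.
  + by lia.
  + by have := s1 t tr; lia.
  + exact: s0.
  + exact: s2.
- by case.
- by case.
- case=> [[sz]] s0 s1 s2; rewrite mem_chainsS.
  have /= := s0 isT; have /= := s1 0 isT; rewrite addn0 => /andP[-> ->] ->.
  apply: IHr; split=> // [r0|t tr|t tr]; first by have /= -> := s2 0 r0.
    by have /= := s1 t.+1 tr; lia.
  exact: (s2 t.+1 tr).
Qed.

(** * Bijection between chains and disjoint families *)

Definition chain_family n k l (s : seq (nat * nat)) : path_family n k :=
  [ffun i : pidx n k =>
    if (l <= i < k)%N
    then vpath i (nth (0, 0)%N s (i - l)).1 (nth (0, 0)%N s (i - l)).2
    else hseg 0 (2 * (i : nat)%:Z - 2) i.-1].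

Lemma pidx_gt0 n k (i : pidx n k) : (0 < i)%N.
Proof. by case/andP: (valP i). Qed.

Lemma pidx_neq n k (i : pidx n k) : (i : nat) != k.
Proof. by case/andP: (valP i). Qed.

Lemma pidx_eq n k (i j : pidx n k) : (i == j) = (i == j :> nat).
Proof. by rewrite -!val_eqE. Qed.

Lemma ex_pidx n k i : (1 <= i < k)%N -> (k <= n)%N ->
  exists i' : pidx n k, i' = i :> nat.
Proof.
move=> /andP[i1 ik] kn; have iP : (i < n.+1)%N by lia.
have iQ : (1 <= Ordinal iP)%N && (Ordinal iP != k :> nat) by rewrite /=; lia.
by exists (exist _ (Ordinal iP) iQ).
Qed.

Lemma sum_pidx n k l (G : nat -> int) : (k <= n)%N -> (1 <= l)%N ->
  \sum_(i : pidx n k) (if (l <= i < k)%N then G i else 0) =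
  \sum_(l <= i < k) G i.
Proof.
move=> kn l1.
transitivity (\sum_(i < n.+1 | (1 <= i)%N && (i != k :> nat))
    if (l <= i < k)%N then G i else 0).
  rewrite [RHS](reindex_omap (val : pidx n k -> _) insub); last first.
    by move=> i iP; rewrite insubT.
  by apply: eq_bigl => i; rewrite valK eqxx andbT; apply/esym/(valP i).
rewrite -big_mkcondr big_geq_mkord (big_ord_widen_cond n.+1); last by lia.
by apply: eq_bigl => i; lia.
Qed.

Lemma psi_chain_family (F : fieldType) (q : F) n k l (s : seq (nat * nat)) :
    (l <= k <= n)%N -> (1 <= l)%N -> s \in chains (k - l) l 0 ->
  psi q (chain_family n k l s) = q ^+ (\sum_(ab <- s) (ab.1 + ab.2)).
Proof.
move=> /andP[lk kn] l1 /chainsP[sz _ sP _].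
rewrite /psi exprnP; congr (q ^ _).
pose G i := ((nth (0, 0)%N s (i - l)).1 + (nth (0, 0)%N s (i - l)).2)%N%:Z.
transitivity (\sum_(i : pidx n k) if (l <= i < k)%N then G i else 0).
  apply: eq_bigr => i _; rewrite ffunE; case: ifP => [ilk|_].
    have [|abP _] := andP (sP (pidx_nat i - l)%N _); first by lia.
    by rewrite path_area_vpath.
  by rewrite path_area_hseg.
rewrite sum_pidx // -{1}[l]add0n big_addn -sz (big_nth (0, 0)%N).
rewrite (big_morph Posz PoszD (erefl _)).
by apply: eq_bigr => t _; rewrite /G addnK.
Qed.

Lemma chain_family_inj n k l (s s' : seq (nat * nat)) :
    (l <= k <= n)%N -> (1 <= l)%N ->
    s \in chains (k - l) l 0 -> s' \in chains (k - l) l 0 ->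
  chain_family n k l s = chain_family n k l s' -> s = s'.
Proof.
move=> /andP[lk kn] l1 /chainsP[sz _ sP _] /chainsP[sz' _ sP' _] E.
apply: (@eq_from_nth _ (0, 0)%N) => [|t]; first by rewrite sz sz'.
rewrite sz => tr; have [||i iE] := @ex_pidx n k (t + l)%N; try lia.
move/ffunP/(_ i): E.
rewrite !ffunE iE addnK leq_addl (_ : t + l < k)%N; last by lia.
move/vpath_inj; rewrite -!surjective_pairing; apply.
  by have := sP t tr; rewrite addnC.
by have := sP' t tr; rewrite addnC.
Qed.

(** For [l <= i < k] the path of index [i] occupies the heights [2i-2] to [2i], so two such paths
    can meet only if consecutive, at height [2i]. There the abscissas are [[0, a_i]] and
    [[b_(i+1), i]]. The horizontal paths have heights of their own. *)
Lemma disjoint_families_chains n k l : (l <= k <= n)%N -> (1 <= l)%N ->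
  disjoint_families n k l =
  [set` [seq chain_family n k l s | s <- chains (k - l) l 0]]%classic.
Proof.
move=> /andP[lk kn] l1; apply/seteqP; split=> Om /=; last first.
  case/mapP=> s /chainsP[sz _ sP s_lt] ->; split=> [i|i j].
    rewrite ffunE /path_start; have i0 := pidx_gt0 i.
    case: ifP => ilk; last exact/lattice_path_ptAB.
    apply/lattice_path_vpath => //; exists (nth (0, 0)%N s (i - l)).1.
    exists (nth (0, 0)%N s (i - l)).2; split=> //.
    have := sP (pidx_nat i - l)%N; rewrite subnKC; last by lia.
    by apply; lia.
  move=> ij; have {}ij : i != j :> nat by rewrite -pidx_eq.
  pose a t := (nth (0, 0)%N s (t - l)).1.
  pose b t := (nth (0, 0)%N s (t - l)).2.
  have abP t : (l <= t < k)%N -> (a t <= b t < t)%N.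
    move=> tlk; have := sP (t - l)%N; rewrite subnKC; last by lia.
    by apply; lia.
  have ab_lt t : (l <= t)%N -> (t.+1 < k)%N -> (a t < b t.+1)%N.
    by move=> lt tk; rewrite /b subSn // s_lt; lia.
  have i0 := pidx_gt0 i; have j0 := pidx_gt0 j.
  have ik := pidx_neq i; have jk := pidx_neq j.
  have iP := abP i; have jP := abP j.
  (* The indices are not ordered, so both cases of adjacency are prepared for [lia]. *)
  have ijP : i.+1 = j :> nat -> (l <= i)%N -> (j < k)%N -> (a i < b j)%N.
    by move=> <-; apply: ab_lt.
  have jiP : j.+1 = i :> nat -> (l <= j)%N -> (i < k)%N -> (a j < b i)%N.
    by move=> <-; apply: ab_lt.
  apply/hasPn => -[u v].
  rewrite !ffunE -/(a i) -/(b i) -/(a j) -/(b j) [mem _ _]inE.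
  move: (a i) (a j) (b i) (b j) iP jP ijP jiP => ai aj bi bj iP jP ijP jiP.
  case: ifP => jlk; case: ifP => ilk.
  - by rewrite !mem_vpath ?iP ?jP //=; have := iP ilk; have := jP jlk; lia.
  - by rewrite mem_vpath ?jP //= mem_hseg /=; have := jP jlk; lia.
  - by rewrite mem_hseg mem_vpath ?iP //=; have := iP ilk; lia.
  - by rewrite !mem_hseg /=; lia.
move=> [OmP Om_disj].
(* Pairs are chosen by offset [t = i - l], to be listed by [mkseq]; the default for [t + l >= k] is
   never read. *)
have /choice[f fP] (t : nat) : exists ab : nat * nat, forall i : pidx n k,
    (i = t + l :> nat)%N -> (t + l < k)%N ->
  (ab.1 <= ab.2 < i)%N /\ Om i = vpath i ab.1 ab.2.
  have [tlk|] := ltnP (t + l) k; last by exists (0, 0)%N; lia.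
  have [||i iE] := @ex_pidx n k (t + l)%N; try lia.
  have := OmP i; rewrite /path_start ifT; last by lia.
  case/(lattice_path_vpath _ (pidx_gt0 i)) => a [b [abP OmE]].
  exists (a, b) => j jE _.
  suff -> : j = i by [].
  by apply/eqP; rewrite pidx_eq jE iE.
apply/mapP; exists (mkseq f (k - l)).
  apply/chainsP; split=> //; first by rewrite size_mkseq.
  - move=> t tr; rewrite nth_mkseq //.
    have [||i iE] := @ex_pidx n k (t + l)%N; try lia.
    have [|abP _] := fP t i iE; first by lia.
    by rewrite addnC -iE.
  - move=> t tr; rewrite !nth_mkseq //; last by lia.
    have [||i iE] := @ex_pidx n k (t + l)%N; try lia.
    have [||j jE] := @ex_pidx n k (t.+1 + l)%N; try lia.
    have [|abP OmE] := fP t i iE; first by lia.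
    have [|abP' OmE'] := fP t.+1 j jE; first by lia.
    have ij : i != j by rewrite pidx_eq; lia.
    (* If [b_(i+1) <= a_i], the right end [(a_i, 2i)] of the top row of path [i] lies on the bottom
       row of path [i+1]. *)
    rewrite ltnNge; apply/negP => ba; have /hasPn := Om_disj i j ij.
    move/(_ ((f t).1%:Z, 2 * (i : nat)%:Z)); rewrite OmE OmE' /=.
    by rewrite !mem_vpath //=; lia.
apply/ffunP => i; rewrite ffunE; have := OmP i; rewrite /path_start.
case: ifP => ilk; last by move/(lattice_path_ptAB _ (pidx_gt0 i)).
have iE : (pidx_nat i = pidx_nat i - l + l)%N by lia.
have [|_ ->] := fP _ i iE; first by lia.
by rewrite nth_mkseq //; lia.
Qed.

Theorem theorem8 (F : fieldType) (q : F) (q_neq0 : q != 0)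
    (q_nonroot : forall r : nat, (0 < r)%N -> q ^+ r != 1)
    (d : nat -> nat -> F)
    (dE : lower_inverse (Hq q) (fun i j => (-1) ^+ (i - j) * d i j))
    (n k l : nat) (kn : (k <= n)%N) (lk : (l <= k)%N) (l1 : (1 <= l)%N) :
  d k l = \sum_(Omega \in disjoint_families n k l) psi q Omega.
Proof.
have lkn : (l <= k <= n)%N by rewrite lk.
rewrite (inverse_chain_gf q_neq0 q_nonroot dE) ?l1 // chain_gf_chains.
rewrite disjoint_families_chains // -fsbig_seq; last first.
  rewrite map_inj_in_uniq ?chains_uniq // => s s' sP s'P.
  exact: chain_family_inj.
rewrite big_map [RHS]big_seq [LHS]big_seq; apply: eq_bigr => s sP.
by rewrite psi_chain_family.
Qed.
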